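(* Let $n\ge2$ be an integer. (1) $\mathrm{Spec}(\mathbb Z_n)=\mathrm{Max}(\mathbb Z_n)$ is discrete, whence $T_2$. (2) For the Boolean semiring $\mathbb B$, $\mathrm{Spec}(\mathbb B)=\mathrm{Max}(\mathbb B)=\{\{0\}\}$ is discrete, whence $T_2$. (3) If $n\ge3$, then $\mathrm{Spec}(B(n,1))$ is, as a poset under inclusion, a $\mathcal V_{\omega(n-1)}$, whence it is $T_{\frac12}$ but not $T_{\frac34}$. (4) If $n\ge3$, then $\mathrm{Spec}(B(n,n-1))$ is, as a poset under inclusion, a two-element chain $\mathcal C_2=\mathcal V_1$, whence it is $T_{\frac12}$ but not $T_{\frac34}$. (5) If $n\ge4$ and $2\le i\le n-2$, then $\mathrm{Spec}(B(n,i))$ is $T_0$ but not $T_{\frac14}$.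
   Context: A semiring is a set with operations $+,\cdot$ such that $(R,+,0)$ is a commutative monoid, $(R,\cdot,1)$ is a monoid, multiplication distributes over addition, $0$ is absorbing, and $1\ne0$. Ideals of a commutative semiring are additive submonoids closed under multiplication by $R$; prime and maximal ideals are (proper and) defined as for rings; $\mathrm{Spec}(R)$ is the set of prime ideals with the Zariski topology (closed sets $\{P: I\subseteq P\}$, $I$ an ideal), $\mathrm{Max}(R)$ the set of maximal ideals. For $n\ge2$ and $0\le i\le n-1$, $B(n,i)$ is the commutative semiring on $\{0,1,\dots,n-1\}$ with operations: $x\oplus y=x+y$ if $x+y\le n-1$, otherwise the unique integer $u$ with $i\le u\le n-1$ and $u\equiv x+y \pmod{n-i}$; $x\odot y=xy$ if $xy\le n-1$, otherwise the unique integer $v$ with $i\le v\le n-1$ and $v\equiv xy\pmod{n-i}$. Thus $B(n,0)=\mathbb Z_n$ and $B(2,1)=\mathbb B=\{0,1\}$ with $1+1=1$. For $k\ge2$, $\omega(k)$ is the number of distinct prime divisors of $k$. $\mathcal V_m$ is the poset consisting of one minimal element lying under $m$ pairwise incomparable maximal elements. A topological space $X$ is $T_{\frac14}$ iff for every $x\in X$, $\{x\}$ is closed or equals the intersection of all open sets containing $x$; $T_{\frac12}$ iff for every $x$, $\{x\}$ is closed or open; $T_{\frac34}$ iff for every $x$, $\{x\}$ is closed or $\{x\}=\mathrm{int}(\overline{\{x\}})$. *)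

(* Defs.v *)
From HB Require Import structures.
From mathcomp Require Import all_boot all_order all_algebra.
From mathcomp Require Import all_classical.
From mathcomp Require Import topology.

Set Implicit Arguments.
Unset Strict Implicit.
Unset Printing Implicit Defensive.

Import Order.TTheory GRing.Theory.
Local Open Scope classical_set_scope.
Local Open Scope ring_scope.

Section Ideals.
Variable R : comNzSemiRingType.
Implicit Types I J M P : set R.

Definition is_ideal I : Prop :=
  [/\ I 0, (forall x y, I x -> I y -> I (x + y)) &
      (forall a x, I x -> I (a * x))].

Definition is_prime_ideal P : Prop :=
  [/\ is_ideal P, P <> setT & forall x y, P (x * y) -> P x \/ P y].

Definition is_maximal_ideal M : Prop :=
  [/\ is_ideal M, M <> setT &
      forall J, is_ideal J -> M `<=` J -> J = M \/ J = setT].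

Definition prime_ideals : set (set R) := [set P | is_prime_ideal P].
Definition maximal_ideals : set (set R) := [set M | is_maximal_ideal M].

End Ideals.

Arguments prime_ideals : clear implicits.
Arguments maximal_ideals : clear implicits.

Definition Spec (R : comNzSemiRingType) : Type :=
  {P : set R | P \in prime_ideals R}.

HB.instance Definition _ (R : comNzSemiRingType) :=
  SubChoice.copy (Spec R) {P : set R | P \in prime_ideals R}.

Fact spec_display : Order.disp_t. Proof. by []. Qed.

(* the order on [set R] of the library is inclusion *)
HB.instance Definition _ (R : comNzSemiRingType) :=
  [SubChoice_isSubPOrder of Spec R by <: with spec_display].

Section Zariski.
Variable R : comNzSemiRingType.

Lemma SpecP (P : Spec R) : is_prime_ideal (val P).
Proof. exact: set_mem (valP P). Qed.

Lemma Spec_leE (P Q : Spec R) : (P <= Q)%O = `[< val P `<=` val Q >].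
Proof. by []. Qed.

Definition zariski_closed (I : set R) : set (Spec R) :=
  [set P | I `<=` val P].

Definition zariski_open (U : set (Spec R)) : Prop :=
  exists2 I : set R, is_ideal I & U = ~` zariski_closed I.

Lemma zariski_openT : zariski_open setT.
Proof.
exists setT; first by [].
apply/esym/seteqP; split => // P _ /= sTP.
by have [_ + _] := SpecP P; apply; apply/seteqP; split.
Qed.

Lemma zariski_openI : setI_closed zariski_open.
Proof.
move=> _ _ [I [I0 ID IM] ->] [J [J0 JD JM] ->]; exists (I `&` J).
  split=> //= [x y [? ?] [? ?]|a x [? ?]].
    by split; [exact: ID|exact: JD].
  by split; [exact: IM|exact: JM].
rewrite -setCU; congr (~` _); apply/seteqP; split=> P /=.
  by case=> s x [? ?]; exact: s.
move=> sIJ; apply: contrapT => /not_orP[/existsNP[x /not_implyP[Ix Px]]].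
move=> /existsNP[y /not_implyP[Jy Py]].
have [_ _ prP] := SpecP P.
have : val P (x * y).
  by apply: sIJ => /=; split; [rewrite mulrC; exact: IM|exact: JM].
by move=> /prP[].
Qed.

Lemma zariski_open_bigU (K : Type) (f : K -> set (Spec R)) :
  (forall k, zariski_open (f k)) -> zariski_open (\bigcup_k f k).
Proof.
move=> fo; pose I k : set R := s2val (cid2 (fo k)).
have II k : is_ideal (I k) by rewrite /I; case: (cid2 (fo k)).
have fE k : f k = ~` zariski_closed (I k) by rewrite /I; case: (cid2 (fo k)).
exists [set x | forall J, is_ideal J -> (forall k, I k `<=` J) -> J x].
  split=> /= [J [] //|x y Jx Jy J iJ sJ|a x Jx J iJ sJ].
    by have [_ JD _] := iJ; apply: JD; [exact: Jx|exact: Jy].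
  by have [_ _ JM] := iJ; apply: JM; exact: Jx.
apply/seteqP; split=> P /=.
  move=> [k _]; rewrite fE /= => nIP sP; apply: nIP => x Ix; apply: sP.
  by move=> J _ sJ; exact: (sJ k).
move=> nP; apply: contrapT => nfP; apply: nP => x /=; apply.
  by have [] := SpecP P.
move=> k; apply: contrapT => nIP; apply: nfP; exists k => //.
by rewrite fE.
Qed.

HB.instance Definition _ := isOpenTopological.Build (Spec R)
  zariski_openT zariski_openI zariski_open_bigU.

Lemma Spec_openE (U : set (Spec R)) : open U = zariski_open U.
Proof. by []. Qed.

End Zariski.

Section SeparationAxioms.
Variable X : topologicalType.

Definition discrete_top : Prop := forall A : set X, open A.

Definition T14 : Prop := forall x : X,
  closed [set x] \/ [set x] = \bigcap_(U in [set V | open V /\ V x]) U.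

Definition T12 : Prop := forall x : X, closed [set x] \/ open [set x].

Definition T34 : Prop := forall x : X,
  closed [set x] \/ [set x] = interior (closure [set x]).

End SeparationAxioms.

Arguments discrete_top : clear implicits.
Arguments T14 : clear implicits.
Arguments T12 : clear implicits.
Arguments T34 : clear implicits.

Definition order_isomorphic d d' (S : porderType d) (T : porderType d') :=
  exists2 f : S -> T, bijective f & {mono f : x y / (x <= y)%O}.

(* [None] is the minimal element and the [Some k] are the maximal ones *)
Definition Vposet (m : nat) : Type := option 'I_m.

HB.instance Definition _ m := Finite.copy (Vposet m) (option 'I_m).

Section VposetOrder.
Variable m : nat.

Definition Vposet_le (x y : Vposet m) : bool := (x == None) || (x == y).

Lemma Vposet_le_refl : reflexive Vposet_le.
Proof. by move=> x; rewrite /Vposet_le eqxx orbT. Qed.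

Lemma Vposet_le_anti : antisymmetric Vposet_le.
Proof. by move=> [x|] [y|] //; rewrite /Vposet_le => /andP[/eqP]. Qed.

Lemma Vposet_le_trans : transitive Vposet_le.
Proof.
move=> y x z /orP[/eqP->|/eqP->]; first by rewrite /Vposet_le.
by [].
Qed.

Fact Vposet_display : Order.disp_t. Proof. by []. Qed.

HB.instance Definition _ := Order.Le_isPOrder.Build Vposet_display (Vposet m)
  Vposet_le_refl Vposet_le_anti Vposet_le_trans.

End VposetOrder.

Definition omega (k : nat) : nat := size (primes k).

Section Bred.
Local Open Scope nat_scope.
Variables n i : nat.

(* representative in {0, ..., n-1} of the result z of an operation on
   natural numbers; see [bred_spec] and [bred_uniq] *)
Definition bred (z : nat) : nat :=
  if z <= n - 1 then z else i + (z - i) %% (n - i).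

Hypothesis hi : i < n.

Lemma bred_spec z : n - 1 < z ->
  (i <= bred z <= n - 1) /\ bred z = z %[mod n - i].
Proof.
have n0 : 0 < n by exact: leq_ltn_trans hi.
move=> hz; rewrite /bred; have -> : (z <= n - 1) = false by rewrite leqNgt hz.
move: hz; rewrite subn1 prednK // => nz; split.
  by rewrite leq_addr /= -ltnS prednK // -ltn_subRL ltn_mod subn_gt0.
by rewrite modnDmr subnKC // (leq_trans (ltnW hi)).
Qed.

Lemma bred_uniq u v : i <= u <= n - 1 -> i <= v <= n - 1 ->
  u = v %[mod n - i] -> u = v.
Proof.
have n0 : 0 < n by exact: leq_ltn_trans hi.
move=> /andP[iu un] /andP[iv vn] /eqP.
rewrite -(subnKC iu) -(subnKC iv) eqn_modDl.
have lt w : w <= n - 1 -> w - i < n - i.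
  by move=> wn; rewrite ltn_sub2r // -(prednK n0) ltnS -subn1.
by rewrite !modn_small ?lt // => /eqP->.
Qed.

Lemma bredE z : bred z = if z < i then z else i + (z - i) %% (n - i).
Proof.
have n0 : 0 < n by exact: leq_ltn_trans hi.
rewrite /bred subn1 -ltnS prednK //.
have [zn|nz] := ltnP z n; last by rewrite ltnNge (leq_trans (ltnW hi) nz).
have [//|iz] := ltnP z i.
by rewrite modn_small ?subnKC // ltn_sub2r.
Qed.

Lemma bred_lt z : bred z < n.
Proof.
rewrite bredE; case: (ltnP z i) => [zi|_]; first exact: ltn_trans zi hi.
by rewrite -ltn_subRL ltn_mod subn_gt0.
Qed.

Lemma bred_small z : z < n -> bred z = z.
Proof.
by move=> zn; rewrite /bred subn1 -ltnS prednK ?zn //; exact: (leq_ltn_trans (leq0n z)).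
Qed.

Lemma bredDM z k : i <= z -> bred (z + k * (n - i)) = bred z.
Proof.
move=> iz; rewrite !bredE ltnNge (leq_trans iz (leq_addr _ _)) /=.
by rewrite ltnNge iz /= -addnBAC // [z - i + _]addnC modnMDl.
Qed.

Lemma bred_decomp z :
  bred z = z \/ i <= bred z /\ exists k, z = bred z + k * (n - i).
Proof.
rewrite bredE; case: (ltnP z i) => [|iz]; first by left.
right; split; first exact: leq_addr.
exists ((z - i) %/ (n - i)).
by rewrite -addnA [X in i + X]addnC -divn_eq subnKC.
Qed.

Lemma bredDl a b : bred (bred a + b) = bred (a + b).
Proof.
have [->//|[ia [k ak]]] := bred_decomp a.
by rewrite [in RHS]ak addnAC bredDM // (leq_trans ia) // leq_addr.
Qed.

Lemma bredMl a b : bred (bred a * b) = bred (a * b).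
Proof.
have [->//|[ia [k ak]]] := bred_decomp a.
case: b => [|b]; first by rewrite !muln0.
rewrite [in RHS]ak mulnDl mulnAC bredDM // (leq_trans ia) //.
by rewrite leq_pmulr.
Qed.

Lemma bredDr a b : bred (a + bred b) = bred (a + b).
Proof. by rewrite addnC bredDl addnC. Qed.

Lemma bredMr a b : bred (a * bred b) = bred (a * b).
Proof. by rewrite mulnC bredMl mulnC. Qed.

End Bred.

(* The two proofs are arguments of the type so that its semiring structure can
   be inferred. *)
Definition Bsr (n i : nat) (hn : (1 < n)%N) (hi : (i < n)%N) : Type := 'I_n.

HB.instance Definition _ n i hn hi := Finite.copy (@Bsr n i hn hi) 'I_n.
HB.instance Definition _ n i hn hi := SubType.copy (@Bsr n i hn hi) 'I_n.

Section BsrSemiring.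
Variables (n i : nat) (hn : (1 < n)%N) (hi : (i < n)%N).
Local Notation B := (Bsr hn hi).

Definition Bsr_of_nat (z : nat) : B := Ordinal (bred_lt hi z).
Definition Bsr_zero : B := Ordinal (ltnW hn).
Definition Bsr_one : B := Ordinal hn.
Definition Bsr_add (x y : B) : B := Bsr_of_nat (val x + val y).
Definition Bsr_mul (x y : B) : B := Bsr_of_nat (val x * val y).

Lemma Bsr_addA : associative Bsr_add.
Proof. by move=> x y z; apply: val_inj; rewrite /= bredDr // bredDl // addnA. Qed.

Lemma Bsr_addC : commutative Bsr_add.
Proof. by move=> x y; apply: val_inj; rewrite /= addnC. Qed.

Lemma Bsr_add0 : left_id Bsr_zero Bsr_add.
Proof. by move=> x; apply: val_inj; rewrite /= add0n bred_small. Qed.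

HB.instance Definition _ := GRing.isNmodule.Build B Bsr_addA Bsr_addC Bsr_add0.

Lemma Bsr_mulA : associative Bsr_mul.
Proof. by move=> x y z; apply: val_inj; rewrite /= bredMr // bredMl // mulnA. Qed.

Lemma Bsr_mulC : commutative Bsr_mul.
Proof. by move=> x y; apply: val_inj; rewrite /= mulnC. Qed.

Lemma Bsr_mul1 : left_id Bsr_one Bsr_mul.
Proof. by move=> x; apply: val_inj; rewrite /= mul1n bred_small. Qed.

Lemma Bsr_mulDl : left_distributive Bsr_mul Bsr_add.
Proof.
move=> x y z; apply: val_inj.
by rewrite /= bredMl // bredDl // bredDr // mulnDl.
Qed.

Lemma Bsr_mul0 : left_zero Bsr_zero Bsr_mul.
Proof. by move=> x; apply: val_inj; rewrite /= mul0n bred_small // ltnW. Qed.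

Lemma Bsr_one_neq0 : Bsr_one != Bsr_zero.
Proof. by []. Qed.

HB.instance Definition _ := GRing.Nmodule_isComNzSemiRing.Build B
  Bsr_mulA Bsr_mulC Bsr_mul1 Bsr_mulDl Bsr_mul0 Bsr_one_neq0.

End BsrSemiring.

Arguments Bsr : clear implicits.

Lemma ltn_sub1 n : (1 < n)%N -> (n - 1 < n)%N.
Proof. by move=> hn; rewrite subn1 ltn_predL ltnW. Qed.

(* the Boolean semiring is B(2, 1) *)
Definition BoolSr : comNzSemiRingType := Bsr 2 1 isT isT.

Lemma BoolSr_1D1 : 1 + 1 = 1 :> BoolSr.
Proof. exact: val_inj. Qed.

(* B(n, 0) is the library's ring of integers modulo n *)
Lemma Bsr0_Zp n (hn : (1 < n)%N) (h0 : (0 < n)%N) :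
  exists f : Bsr n 0 hn h0 -> 'Z_n, [/\ bijective f, f 0 = 0, f 1 = 1,
    {morph f : x y / x + y} & {morph f : x y / x * y}].
Proof.
have redE z : (bred n 0 z)%:R = z%:R :> 'Z_n.
  by rewrite bredE // ltn0 add0n !subn0 Zp_nat_mod.
exists (fun x => (val x)%:R); split=> // [|x y|x y].
- apply: inj_card_bij; last by rewrite !card_ord Zp_cast.
  move=> x y /(congr1 val); rewrite /= !val_Zp_nat // !modn_small //.
  exact: val_inj.
- by rewrite redE natrD.
- by rewrite redE natrM.
Qed.

(* Main.v *)
(** The open sets of a finite spectrum are its down-closed subsets, so every
    separation axiom can be read off the inclusion order: an antichain is
    discrete, the generic point of a [Vposet m] with [0 < m] is open and dense,
    and the middle point of a chain [P < Q < M] is neither closed nor an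
    intersection of open sets.

    For [0 < i] the ideal {0} of B(n, i) is prime, and so is the ideal of
    multiples of any prime divisor [p] of [n - i]; for [1 < i] the complement
    of {1} is prime as well.  For [i = 1] and [i = n - 1] a nonzero ideal
    contains [n - 1], the image of every positive multiple of [n - 1], which
    forces a nonzero prime to be one of these. *)

Require Import Defs.
From HB Require Import structures.
From mathcomp Require Import all_boot all_order all_algebra.
From mathcomp Require Import all_classical.
From mathcomp Require Import topology.

Set Implicit Arguments.
Unset Strict Implicit.
Unset Printing Implicit Defensive.

Import Order.TTheory GRing.Theory.
Local Open Scope classical_set_scope.
Local Open Scope ring_scope.

(** * Ideals of commutative semirings *)

Section Ideals.
Variable R : comNzSemiRingType.
Implicit Types (I J M P : set R).

Lemma ideal_proper I : is_ideal I -> I <> setT <-> ~ I 1.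
Proof.
move=> [_ _ IM]; split=> [nT I1|n1 IT]; last by apply: n1; rewrite IT.
by apply/nT/seteqP; split=> // a _; rewrite -[a]mulr1; exact: IM.
Qed.

(** If [x] is not in [M], the ideal [M + R x] contains 1; multiplying [1 = m + a * x] by [y] puts
    [y] in [M]. *)
Lemma maximal_is_prime M : is_maximal_ideal M -> is_prime_ideal M.
Proof.
move=> [iM nT maxM]; have [M0 MD MM] := iM; split=> // x y Mxy.
apply: contrapT => /not_orP[nMx nMy].
pose J : set R := [set z | exists m a, M m /\ z = m + a * x].
have iJ : is_ideal J.
  split=> [|_ _ [m [a [Mm ->]]] [k [b [Mk ->]]]|c _ [m [a [Mm ->]]]].
  - by exists 0, 0; rewrite mul0r addr0.
  - by exists (m + k), (a + b); rewrite mulrDl addrACA; split=> //; exact: MD.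
  - by exists (c * m), (c * a); rewrite mulrDr mulrA; split=> //; exact: MM.
have MJ : M `<=` J by move=> m Mm; exists m, 0; rewrite mul0r addr0.
have Jx : J x by exists 0, 1; rewrite add0r mul1r.
have [JM|JT] := maxM _ iJ MJ; first by apply: nMx; rewrite -JM.
have : J 1 by rewrite JT.
move=> [m [a [Mm e1]]]; apply: nMy.
rewrite -[y]mul1r e1 mulrDl -mulrA; apply: MD; last exact: MM.
by rewrite mulrC; exact: MM.
Qed.

Lemma set0_ideal : is_ideal ([set 0] : set R).
Proof. by split=> [//|_ _ -> ->|a _ ->] /=; rewrite ?addr0 ?mulr0. Qed.

Lemma prime_idealX P (x : R) k :
  is_prime_ideal P -> P (x ^+ k) -> P x.
Proof.
move=> [iP PT prP]; elim: k => [|k IHk]; last by rewrite exprS => /prP[].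
by rewrite expr0 => P1; have /(ideal_proper iP) := PT.
Qed.

End Ideals.

Lemma discrete_top_hausdorff (X : topologicalType) :
  discrete_top X -> hausdorff_space X.
Proof.
move=> dX p q /(_ [set p] [set q]) [||x [-> ->]] //;
  by apply: open_nbhs_nbhs; split=> //; exact: dX.
Qed.

(** * The Zariski topology read off the inclusion order *)

Section SpecTopology.
Variable R : comNzSemiRingType.
Implicit Types (P Q : Spec R) (A : set (Spec R)).

Definition prime_point (I : set R) (pI : is_prime_ideal I) : Spec R :=
  exist _ I (mem_set (pI : prime_ideals R I)).

Lemma Spec_leP P Q : reflect (val P `<=` val Q) (P <= Q)%O.
Proof. by rewrite Spec_leE; exact: asboolP. Qed.

Lemma closed_zariski_closed (I : set R) :
  is_ideal I -> closed (zariski_closed I).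
Proof. by move=> iI; rewrite -openC Spec_openE; exists I. Qed.

Lemma open_down A P Q : open A -> (P <= Q)%O -> A Q -> A P.
Proof.
rewrite Spec_openE => -[I _ ->] /Spec_leP PQ /= nIQ IP; apply: nIQ.
exact: subset_trans PQ.
Qed.

Lemma closure1 P : closure [set P] = [set Q | (P <= Q)%O].
Proof.
apply/seteqP; split=> [Q|Q PQ B].
  rewrite closureE; apply; split=> [|_ -> /=]; last exact: lexx.
  have -> : [set Q | (P <= Q)%O] = zariski_closed (val P).
    by apply/seteqP; split=> Q' /Spec_leP.
  by apply: closed_zariski_closed; have [] := SpecP P.
rewrite nbhsE => -[U [oU UQ] UB]; exists P; split=> //.
exact/UB/(open_down oU PQ).
Qed.

Lemma closed1P P : closed [set P] <-> forall Q, (P <= Q)%O -> Q = P.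
Proof.
rewrite closure_id closure1; split=> [e Q PQ|maxP].
  by suff : [set P] Q by []; rewrite e.
by apply/seteqP; split=> [_ ->|Q /maxP] //=; exact: lexx.
Qed.

Lemma Spec_kolmogorov : kolmogorov_space (Spec R).
Proof.
have sep P Q : ~~ (P <= Q)%O -> exists A, A \in nbhs Q /\ P \in ~` A.
  move=> PQ; exists (~` closure [set P]); split; rewrite inE.
    apply: open_nbhs_nbhs; split; last by rewrite closure1 /=; exact/negP.
    exact/closed_openC/closed_closure.
  by apply; exact: subset_closure.
move=> P Q; rewrite eq_le negb_and => /orP[/sep|/sep] [A AP]; exists A.
  by right.
by left.
Qed.

Lemma chain3_not_T14 P Q M : (P < Q)%O -> (Q < M)%O -> ~ T14 (Spec R).
Proof.
move=> PQ QM /(_ Q)[/closed1P/(_ M (ltW QM)) e|e].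
  by move: QM; rewrite e ltxx.
have : [set Q] P by rewrite e => U /= [oU UQ]; exact: open_down oU (ltW PQ) UQ.
by move=> /= e'; move: PQ; rewrite e' ltxx.
Qed.

Section Finite.
Hypothesis finS : finite_set [set: Spec R].

(** The complement of a down-closed set is the union of the closures of its points; finiteness makes
    this union closed. *)
Lemma finite_open_down A :
  (forall P Q, (P <= Q)%O -> A Q -> A P) -> open A.
Proof.
move=> dA; rewrite -[A]setCK; apply: closed_openC.
have -> : ~` A = \bigcup_(P in ~` A) closure [set P].
  apply/seteqP; split=> [P nAP|P [Q nAQ]].
    by exists P => //; exact: subset_closure.
  by rewrite closure1 /= => QP /(dA _ _ QP).
apply: closed_bigcup => [|P _]; last exact: closed_closure.
exact: sub_finite_set (@subsetT _ _) finS.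
Qed.

Lemma antichain_discrete :
  (forall P Q, (P <= Q)%O -> P = Q) -> discrete_top (Spec R).
Proof. by move=> anti A; apply: finite_open_down => P Q /anti ->. Qed.

End Finite.

Lemma primes_maximal_discrete :
  finite_set (prime_ideals R) -> prime_ideals R `<=` maximal_ideals R ->
  [/\ prime_ideals R = maximal_ideals R, discrete_top (Spec R) &
      hausdorff_space (Spec R)].
Proof.
move=> fin prmax.
have dS : discrete_top (Spec R).
  apply: antichain_discrete => [|P Q /Spec_leP PQ].
    apply: (@sub_finite_set _ _ (val @^-1` prime_ideals R)).
      by move=> P _; exact: SpecP.
    by apply: finite_preimage => // P Q _ _; exact: val_inj.
  have [_ _ maxP] := prmax _ (SpecP P).
  have [iQ QT _] := SpecP Q.
  by apply: val_inj; have [|//] := maxP _ iQ PQ.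
split=> //; last exact: discrete_top_hausdorff.
by apply/seteqP; split=> // P; exact: maximal_is_prime.
Qed.

(** Maximal points are closed, and the singleton of the minimum is down-closed, hence open. *)
Lemma Vposet_T12 m : order_isomorphic (Spec R) (Vposet m) -> T12 (Spec R).
Proof.
move=> [f bf fle].
have finS : finite_set [set: Spec R].
  apply: (@sub_finite_set _ _ (f @^-1` [set: Vposet m])) => //.
  apply: finite_preimage; last exact: finite_finset.
  by move=> P Q _ _; exact: bij_inj.
move=> P; case fP : (f P) => [k|].
  left; apply/closed1P => Q; rewrite -fle fP => /orP[//|/eqP e].
  by apply: (bij_inj bf); rewrite fP.
right; apply: finite_open_down => // Q Q' QQ' Q'P; move: QQ'.
by rewrite Q'P -fle fP => /orP[|] /eqP e; apply: (bij_inj bf); rewrite fP.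
Qed.

Lemma Vposet_not_T34 m : (0 < m)%N ->
  order_isomorphic (Spec R) (Vposet m) -> ~ T34 (Spec R).
Proof.
move=> m0 [f [g gK fK] fle].
(* [P] is the generic point; [0 < m] supplies a second point [Q]. *)
pose P := g None; pose Q := g (Some (Ordinal m0)).
have QP : Q <> P by move=> /(can_inj fK).
have leP Q' : (P <= Q')%O by rewrite -fle fK.
move=> /(_ P)[/closed1P/(_ Q (leP Q))//|].
have -> : closure [set P] = setT.
  by rewrite closure1; apply/seteqP; split=> // Q' _; exact: leP.
rewrite interiorT => e; apply: QP.
by suff : [set P] Q by []; rewrite e.
Qed.

End SpecTopology.

(** An order embedding is injective by antisymmetry, so surjectivity is all that is left to check;
    choice gives the inverse. *)
Lemma order_isomorphic_surj d d' (S : porderType d) (T : porderType d')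
    (g : T -> S) :
  {mono g : x y / (x <= y)%O} -> (forall s, exists t, g t = s) ->
  order_isomorphic S T.
Proof.
move=> gle /choice[f fK]; exists f; last by move=> x y; rewrite -gle !fK.
by exists g => // t; apply: (inc_inj gle).
Qed.

(** The hypothesis on [q k <= q l] expresses both the injectivity of [q] and the incomparability of
    its values. *)
Lemma order_isomorphic_Vposet d (S : porderType d) m (b : S)
    (q : 'I_m -> S) :
  (forall s, b <= s)%O -> (forall k, q k != b) ->
  (forall k l, (q k <= q l)%O -> k = l) ->
  (forall s, s != b -> exists k, q k = s) -> order_isomorphic S (Vposet m).
Proof.
move=> bmin qb qinj qsurj.
apply: (order_isomorphic_surj
  (g := fun x : Vposet m => if x is Some k then q k else b)).
  move=> [k|] [l|]; rewrite ?lexx ?bmin //.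
  - by apply/idP/idP => [/qinj->|/orP[//|/eqP[->]]]; exact: lexx.
  - by apply/negbTE; apply: contraNN (qb k) => kb; rewrite eq_le kb bmin.
move=> s; have [->|/qsurj[k <-]] := eqVneq s b; first by exists None.
by exists (Some k).
Qed.

Lemma order_isomorphic_Vposet1 d (S : porderType d) :
  order_isomorphic S (Vposet 1) -> order_isomorphic S 'I_2.
Proof.
move=> [f [g gK fK] fle].
apply: (order_isomorphic_surj
  (g := fun j : 'I_2 => g (if j == ord0 then None else Some ord0))).
  by case=> [[|[|//]] ?] [[|[|//]] ?]; rewrite -fle !fK.
move=> s; rewrite -[s]gK; case: (f s) => [k|]; last by exists ord0.
by exists ord_max; rewrite (ord1 k).
Qed.


(** * Prime ideals of finite commutative rings *)

Section FiniteRing.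
Variable R : finComNzRingType.

(* By pigeonhole every [x] satisfies [x ^+ i * (1 - x ^+ k) = 0] with [k > 0],
   so modulo a prime not containing [x] the power [x ^+ k] is [1]. *)
Lemma finite_prime_is_maximal (P : set R) :
  is_prime_ideal P -> is_maximal_ideal P.
Proof.
move=> pP; have [iP PT prP] := pP; split=> // J iJ PJ.
have [JP|/existsNP[x /not_implyP[Jx nPx]]] := pselect (J `<=` P).
  by left; apply/seteqP; split.
right; apply: contrapT => /(ideal_proper iJ); apply.
have /injectivePn[i [j ij xij]] :
    ~~ injectiveb (fun k : 'I_#|R|.+1 => x ^+ k).
  by apply/negP => /injectiveP/leq_card; rewrite card_ord ltnn.
wlog lt_ij : i j ij xij / (i < j)%N.
  move=> W; case: (ltngtP i j) => [|ji|/val_inj e]; first exact: W.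
    by apply: W ji; rewrite // eq_sym.
  by rewrite e eqxx in ij.
have [P0 _ _] := iP; have [_ JD JM] := iJ.
have : P (x ^+ i * (1 - x ^+ (j - i))).
  by rewrite mulrBr mulr1 -exprD subnKC ?(ltnW lt_ij)// xij subrr.
move=> /prP[/(prime_idealX pP)//|/PJ J1].
(* [J] contains [1 - x ^+ (j - i)], and also [x ^+ (j - i)] because the exponent is positive; hence
   it contains 1. *)
rewrite -[1](subrK (x ^+ (j - i))); apply: JD => //.
have [k ->] : exists k, (j - i)%N = k.+1.
  by exists (j - i).-1; rewrite prednK // subn_gt0.
by rewrite exprSr; exact: JM.
Qed.

Lemma finite_set_of_sets (A : set (set R)) : finite_set A.
Proof.
apply: (sub_finite_set
  (B := range (fun X : {set R} => [set x | x \in X]%classic))).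
  move=> I _; exists [set x | `[< I x >]]%SET => //.
  by apply/seteqP; split=> x /=; rewrite inE => /asboolP.
by apply: finite_image; exact: finite_finset.
Qed.

End FiniteRing.

(** * Prime ideals of B(n, i) *)

Section BoundedSemiring.
Variables (n i : nat) (hn : (1 < n)%N) (hi : (i < n)%N).
Local Notation B := (Bsr n i hn hi).
Local Notation phi := (Bsr_of_nat hn hi).
Implicit Types (P : set B) (x y : B).

(** With the next lemmas, [phi] is a surjective semiring morphism from the naturals, so identities
    in B(n, i) can be checked on naturals. *)
Lemma Bsr_of_natD : {morph phi : a b / (a + b)%N >-> a + b}.
Proof. by move=> a b; apply: val_inj; rewrite /= bredDl // bredDr. Qed.

Lemma Bsr_of_natM : {morph phi : a b / (a * b)%N >-> a * b}.
Proof. by move=> a b; apply: val_inj; rewrite /= bredMl // bredMr. Qed.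

Lemma Bsr_of_nat1 : phi 1 = 1.
Proof. by apply: val_inj; rewrite /= bred_small. Qed.

Lemma Bsr_of_natX a k : phi (a ^ k) = phi a ^+ k.
Proof.
elim: k => [|k IHk]; first exact: Bsr_of_nat1.
by rewrite expnS Bsr_of_natM IHk exprS.
Qed.

Lemma Bsr_of_natK x : phi (val x) = x.
Proof. by apply: val_inj; rewrite /= bred_small. Qed.

(** Reduction changes [z] by a multiple of [n - i]. *)
Lemma dvdn_bred d z : (d %| n - i)%N -> (d %| bred n i z)%N = (d %| z)%N.
Proof.
move=> dni; have [->//|[_ [k e]]] := bred_decomp hi z.
by rewrite [in RHS]e dvdn_addl // dvdn_mull.
Qed.

Definition dvd_ideal (d : nat) : set B := [set x | (d %| val x)%N].

Lemma dvd_ideal_prime d :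
  prime d -> (d %| n - i)%N -> is_prime_ideal (dvd_ideal d).
Proof.
move=> pd dni.
have iI : is_ideal (dvd_ideal d).
  rewrite /dvd_ideal; split=> [|x y dx dy|a x dx] /=; first exact: dvdn0.
    by rewrite dvdn_bred // dvdn_add.
  by rewrite dvdn_bred // dvdn_mull.
split=> //.
  apply/(ideal_proper iI); rewrite /dvd_ideal /= dvdn1.
  by case: eqP pd => // ->.
move=> x y; rewrite /dvd_ideal /= dvdn_bred // Euclid_dvdM //.
by move=> /orP[]; [left|right].
Qed.

(** A product not below [i] reduces to a value that is still at least [i > 0], so only a product
    that vanishes in the naturals gives 0. *)
Lemma zero_ideal_prime : (0 < i)%N -> is_prime_ideal ([set 0] : set B).
Proof.
move=> i0; have iI := @set0_ideal B; split=> //.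
  by apply/(ideal_proper iI) => /(congr1 val).
move=> x y /(congr1 val); rewrite /= bredE //.
case: ltnP => [_ /eqP|_ /eqP].
  by rewrite muln_eq0 => /orP[]/eqP e; [left|right]; exact: val_inj.
by rewrite addn_eq0; case: posnP i0 => // ->.
Qed.

Lemma bred_eq1 z : (1 < i)%N -> bred n i z = 1%N -> z = 1%N.
Proof.
move=> i1; rewrite bredE //; case: ltnP => // _ e.
by have := leq_addr ((z - i) %% (n - i)) i; rewrite e leqNgt i1.
Qed.

(** Reduction yields 1 only from 1, and in the naturals 1 arises only as [1 + 0], [0 + 1] or
    [1 * 1]. *)
Lemma non_one_ideal_prime : (1 < i)%N -> is_prime_ideal [set~ 1 : B].
Proof.
move=> i1.
have iI : is_ideal [set~ 1 : B].
  split=> [/(congr1 val)//|x y x1 y1|a x x1] /(congr1 val) /= /(bred_eq1 i1).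
    move=> /eqP; rewrite addn_eq1 => /orP[] /andP[/eqP vx /eqP vy].
      by apply: x1; exact: val_inj.
    by apply: y1; exact: val_inj.
  move=> /eqP; rewrite muln_eq1 => /andP[_ /eqP vx].
  by apply: x1; exact: val_inj.
split=> //; first by apply/(ideal_proper iI); apply.
move=> x y xy; apply: contrapT => /not_orP[/contrapT x1 /contrapT y1].
by apply: xy; rewrite x1 y1 mulr1.
Qed.

(** Strong induction on [d], splitting off its least prime factor; [d = 1] is excluded because [P]
    is proper. *)
Lemma prime_ideal_prime_factor P d : is_prime_ideal P -> (0 < d)%N ->
  P (phi d) -> exists p, [/\ prime p, (p %| d)%N & P (phi p)].
Proof.
move=> pP; have [iP PT prP] := pP.
elim/ltn_ind: d => d IHd d0 Pd.
have d1 : (1 < d)%N.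
  case: d d0 Pd {IHd} => [|[|d]] // _; rewrite Bsr_of_nat1 => P1.
  by have /(ideal_proper iP) := PT.
have de := divnK (pdiv_dvd d).
move: (Pd); rewrite -[in P _]de Bsr_of_natM => /prP[Pq|Pp]; last first.
  by exists (pdiv d); split=> //; [exact: pdiv_prime|exact: pdiv_dvd].
have [||p [pp pdq Pp]] := IHd (d %/ pdiv d)%N _ _ Pq.
- by rewrite ltn_Pdiv // prime_gt1 // pdiv_prime.
- by rewrite divn_gt0 ?pdiv_gt0 // dvdn_leq // pdiv_dvd.
by exists p; split=> //; rewrite -de dvdn_mulr.
Qed.

(** For a nonzero [x = k + 1] in [P], the product [(n - 1) * x] equals [n - 1] plus a multiple of
    [n - i], which reduction discards since [i <= n - 1]. The divisibility condition holds for
    [i = 1] and [i = n - 1]. *)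
Lemma nonzero_ideal_last P : is_ideal P -> P <> [set 0] ->
  (n - i %| n - 1)%N -> P (phi (n - 1)).
Proof.
move=> [P0 _ PM] nP0 /dvdnP[c nc].
have [x Px x0] : exists2 x, P x & x <> 0.
  apply: contrapT => /forall2NP nx; apply: nP0.
  by apply/seteqP; split=> [x Px|_ ->//]; have [|/contrapT] := nx x.
have [k xk] : exists k, val x = k.+1.
  exists (val x).-1; case: (posnP (val x)) => [e|/prednK//].
  by case: x0; exact: val_inj.
have := PM (phi (n - 1)) _ Px.
rewrite -[x]Bsr_of_natK -Bsr_of_natM xk mulnS mulnC {2}nc mulnA.
suff -> : phi (n - 1 + k * c * (n - i)) = phi (n - 1) by [].
by apply: val_inj; rewrite /= bredDM // leq_subRL ?add1n// ltnW.
Qed.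

End BoundedSemiring.

(** * The case i = 1 *)

Section BnOne.
Variables (n : nat) (hn : (1 < n)%N).
Local Notation B := (Bsr n 1 hn hn).
Local Notation phi := (Bsr_of_nat hn hn).

Lemma Bn1_primes (P : set B) : is_prime_ideal P -> P <> [set 0] ->
  exists p, [/\ prime p, (p %| n - 1)%N & P = dvd_ideal p].
Proof.
move=> pP nP0; have [iP PT _] := pP; have [_ PD PM] := iP.
have n10 : (0 < n - 1)%N by rewrite subn_gt0.
have [p [pp pn Pp]] :=
  prime_ideal_prime_factor pP n10 (nonzero_ideal_last iP nP0 (dvdnn _)).
have Pmul c : (p %| c)%N -> P (phi c).
  by move=> /dvdnP[q ->]; rewrite Bsr_of_natM; exact: PM.
exists p; split=> //; apply/seteqP; split=> x; last first.
  by move=> /Pmul; rewrite Bsr_of_natK.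
rewrite /dvd_ideal /= => Px; apply: contrapT => /negP npx.
(* Bezout in subtraction-free form: [p] divides [1 + a * val x], so the image of this sum lies in
   [P]. *)
have [a _] := Bezoutr (val x) (prime_gt0 pp).
have /eqP-> : coprime (val x) p by rewrite coprime_sym prime_coprime.
move=> pax; have /(ideal_proper iP) := PT; apply.
(* [a x + (n - 2) a x] is a multiple of [n - 1], hence acts as [0] on [1] *)
have -> : 1 = phi (1 + a * val x + (n - 2) * (a * val x)).
  rewrite -addnA -mulSn; have -> : (n - 2).+1 = (n - 1)%N.
    by rewrite -subSn // ltnW.
  by apply: val_inj; rewrite /= mulnC bredDM // bred_small.
rewrite Bsr_of_natD; apply: PD; first exact: Pmul.
by rewrite !Bsr_of_natM Bsr_of_natK; do 2!apply: (PM).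
Qed.

Lemma Spec_Bn1_Vposet : order_isomorphic (Spec B) (Vposet (omega (n - 1))).
Proof.
have n10 : (0 < n - 1)%N by rewrite subn_gt0.
pose p (k : 'I_(omega (n - 1))) := nth 0%N (primes (n - 1)) k.
have /all_and2[pp pn] k : prime (p k) /\ (p k %| n - 1)%N.
  have := mem_nth 0%N (ltn_ord k); rewrite -/(p k) mem_primes.
  by case/and3P.
apply: (order_isomorphic_Vposet (b := prime_point (zero_ideal_prime hn hn isT))
  (q := fun k => prime_point (dvd_ideal_prime hn hn (pp k) (pn k)))).
- by move=> s; apply/Spec_leP => _ ->; have [[]] := SpecP s.
- move=> k; apply/eqP => /(congr1 val) /= e.
  (* The nonzero element [n - 1] is a multiple of [p k], which separates this ideal from {0}. *)
  have : dvd_ideal (p k) (phi (n - 1)).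
    by rewrite /dvd_ideal /= dvdn_bred.
  rewrite e => /(congr1 val) /=; rewrite bred_small ?ltn_sub1 // => n0.
  by rewrite n0 in n10.
(* Testing the inclusion on [p k] gives [p l %| p k], an equality of primes. *)
- move=> k l /Spec_leP /(_ (phi (p k))) /=; rewrite /dvd_ideal /=.
  rewrite !dvdn_bred // dvdnn dvdn_prime2 // => /(_ isT).
  by rewrite nth_uniq ?primes_uniq // eq_sym => /eqP/val_inj.
move=> s s0; have [|q [pq qn sq]] := Bn1_primes (SpecP s).
  by move=> e; move/eqP: s0; apply; exact: val_inj.
have qi : (index q (primes (n - 1)) < omega (n - 1))%N.
  by rewrite index_mem mem_primes pq n10.
exists (Ordinal qi); apply: val_inj; rewrite /= sq /p /= nth_index //.
by rewrite mem_primes pq n10.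
Qed.

End BnOne.

(** * The case i = n - 1 *)

Section BnTruncated.
Variables (n : nat) (hn : (1 < n)%N) (hi : (n - 1 < n)%N) (n3 : (3 <= n)%N).
Local Notation B := (Bsr n (n - 1) hn hi).
Local Notation phi := (Bsr_of_nat hn hi).

Lemma Bnn1_primes (P : set B) :
  is_prime_ideal P -> P <> [set 0] -> P = [set~ 1].
Proof.
move=> pP nP0; have [iP PT _] := pP; have [P0 _ _] := iP.
apply/seteqP; split=> [x Px x1|x x1].
  by have /(ideal_proper iP) := PT; apply; rewrite -x1.
have ni : (n - (n - 1))%N = 1%N by rewrite subKn // ltnW.
have := nonzero_ideal_last iP nP0; rewrite ni dvd1n => /(_ isT) Pn.
have [x0|x0] := posnP (val x); first by have -> : x = 0 by exact: val_inj.
have x2 : (1 < val x)%N.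
  by rewrite ltn_neqAle x0 andbT; apply/eqP => e; apply: x1; exact: val_inj.
(* Since [n - i = 1], all naturals from [n - 1] on have the same image; for [x >= 2] the power
   [x ^ (n - 1)] is among them, so it maps into [P]. *)
apply: (prime_idealX (k := n - 1)) pP _.
rewrite -[x]Bsr_of_natK -Bsr_of_natX.
suff -> : phi (val x ^ (n - 1)) = phi (n - 1) by [].
have le : (n - 1 <= val x ^ (n - 1))%N by exact/ltnW/ltn_expl.
have := bredDM hi (val x ^ (n - 1) - (n - 1)) (leqnn (n - 1)).
by rewrite ni muln1 subnKC // => e; exact: val_inj.
Qed.

Lemma Spec_Bnn1_Vposet : order_isomorphic (Spec B) (Vposet 1).
Proof.
have i1 : (1 < n - 1)%N by rewrite ltn_subRL.
pose M : Spec B := prime_point (non_one_ideal_prime hn hi i1).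
apply: (order_isomorphic_Vposet
  (b := prime_point (zero_ideal_prime hn hi (ltnW i1))) (q := fun=> M)).
- by move=> s; apply/Spec_leP => _ ->; have [[]] := SpecP s.
- move=> _; apply/eqP => /(congr1 val) /= e.
  (* As [3 <= n], the element 2 differs from both 0 and 1. *)
  have : [set~ 1 : B] (phi 2).
    by move=> /(congr1 val) /=; rewrite bred_small.
  by rewrite e => /(congr1 val) /=; rewrite bred_small.
- by move=> k l _; rewrite (ord1 k) (ord1 l).
move=> s s0; exists ord0; apply/esym/val_inj; apply: (Bnn1_primes (SpecP s)).
by move=> e; move/eqP: s0; apply; exact: val_inj.
Qed.

End BnTruncated.

(** * The case 2 <= i <= n - 2 *)

Lemma Spec_Bsr_chain3 n i (hn : (1 < n)%N) (hi : (i < n)%N) :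
  (4 <= n)%N -> (2 <= i <= n - 2)%N ->
  exists P Q M : Spec (Bsr n i hn hi), (P < Q)%O /\ (Q < M)%O.
Proof.
move=> n4 /andP[i2 ni2].
have i0 := ltnW i2.
have ni : (1 < n - i)%N by rewrite ltn_subRL addn1 -add2n -leq_subRL.
pose phi := Bsr_of_nat hn hi.
pose p := pdiv (n - i).
have pp : prime p by exact: pdiv_prime.
have pni : (p %| n - i)%N by exact: pdiv_dvd.
exists (prime_point (zero_ideal_prime hn hi i0)),
  (prime_point (dvd_ideal_prime hn hi pp pni)),
  (prime_point (non_one_ideal_prime hn hi i2)).
rewrite !lt_leAnge; split; apply/andP; split.
- by apply/Spec_leP => _ -> /=; rewrite /dvd_ideal /= dvdn0.
(* [n - i] is a nonzero multiple of [p], and it is below [n] because [0 < i]. *)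
- apply/negP => /Spec_leP /(_ (phi (n - i)%N)) /=.
  rewrite /dvd_ideal /= dvdn_bred // => /(_ pni) /(congr1 val) /=.
  rewrite bred_small ?ltn_subrL ?i0 ?(ltnW hn) // => e.
  by rewrite e in ni.
- apply/Spec_leP => x /=; rewrite /dvd_ideal /= => px x1.
  by move: px; rewrite x1 dvdn1; case: eqP pp => // ->.
- apply/negP => /Spec_leP sub.
  (* Otherwise [p] divides both 2 and 3, which are elements as [4 <= n], and hence divides 1. *)
  have pdvd k : (1 < k < n)%N -> (p %| k)%N.
    move=> /andP[k1 kn]; have := sub (phi k).
    rewrite /= /dvd_ideal /= dvdn_bred //.
    apply=> /(congr1 val) /=; rewrite bred_small // => e.
    by rewrite e in k1.
  have : (p %| 3 - 2)%N by rewrite dvdn_sub ?pdvd //= ltnW.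
  by rewrite dvdn1; case: eqP (pp) => // ->.
Qed.

(** * The five cases together *)

Theorem corollary3p31 (n : nat) (hn : (2 <= n)%N) :
  [/\
    (* (1) *)
    [/\ prime_ideals 'Z_n = maximal_ideals 'Z_n,
        discrete_top (Spec 'Z_n) & hausdorff_space (Spec 'Z_n)],
    (* (2) *)
    [/\ prime_ideals BoolSr = maximal_ideals BoolSr,
        maximal_ideals BoolSr = [set [set 0]],
        discrete_top (Spec BoolSr) & hausdorff_space (Spec BoolSr)],
    (* (3) *)
    (3 <= n)%N ->
      [/\ order_isomorphic (Spec (Bsr n 1 hn hn)) (Vposet (omega (n - 1))),
          T12 (Spec (Bsr n 1 hn hn)) & ~ T34 (Spec (Bsr n 1 hn hn))],
    (* (4) *)
    (3 <= n)%N ->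
      [/\ order_isomorphic (Spec (Bsr n (n - 1) hn (ltn_sub1 hn))) 'I_2,
          order_isomorphic (Spec (Bsr n (n - 1) hn (ltn_sub1 hn))) (Vposet 1),
          T12 (Spec (Bsr n (n - 1) hn (ltn_sub1 hn))) &
          ~ T34 (Spec (Bsr n (n - 1) hn (ltn_sub1 hn)))]
  & (* (5) *)
    (4 <= n)%N -> forall (i : nat) (hi : (i < n)%N), (2 <= i <= n - 2)%N ->
      kolmogorov_space (Spec (Bsr n i hn hi)) /\ ~ T14 (Spec (Bsr n i hn hi))].
Proof.
split.
- apply: primes_maximal_discrete; first exact: finite_set_of_sets.
  exact: finite_prime_is_maximal.
- have proper0 (I : set BoolSr) : is_ideal I -> ~ I 1 -> I = [set 0].
    move=> [I0 _ _] I1; apply/seteqP; split=> [|_ ->//] x.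
    have [->//|->//] : x = 0 \/ x = 1.
    by case: x => [[|[|//]] hx]; [left|right]; exact: val_inj.
  have max0 : is_maximal_ideal ([set 0] : set BoolSr).
    split=> [||J iJ _]; first exact: set0_ideal.
      by apply/(ideal_proper (@set0_ideal BoolSr)) => /(congr1 val).
    have [->|/(ideal_proper iJ) J1] := pselect (J = setT); first by right.
    by left; exact: proper0.
  have prE (P : set BoolSr) : is_prime_ideal P -> P = [set 0].
    by move=> [iP /(ideal_proper iP) P1 _]; exact: proper0.
  have [|P /prE-> //|prmax dS hS] := @primes_maximal_discrete BoolSr.
    by apply: (sub_finite_set (B := [set [set 0]])) => // P /prE.
  split=> //; apply/seteqP; split=> [P|_ ->//].
  by rewrite -prmax => /prE.
- move=> n3; have iso := Spec_Bn1_Vposet hn.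
  split=> //; first exact: Vposet_T12 iso.
  apply: Vposet_not_T34 iso.
  (* [n - 1 >= 2] has a prime divisor, so there is at least one maximal point. *)
  by rewrite /omega lt0n size_eq0 primes_eq0 -leqNgt ltn_subRL.
- move=> n3; have iso := Spec_Bnn1_Vposet hn (ltn_sub1 hn) n3.
  split=> //; first exact: order_isomorphic_Vposet1.
    exact: Vposet_T12 iso.
  exact: Vposet_not_T34 iso.
move=> n4 i hi ihi; split; first exact: Spec_kolmogorov.
have [P [Q [M [PQ QM]]]] := Spec_Bsr_chain3 hn hi n4 ihi.
exact: chain3_not_T14 PQ QM.
Qed.
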